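(* Let $p\in[0,1]$. For any routing strategy with splitting probability $p$, load-balanced server assignment, and game payoff $A=-\mathbb{E}[o_A o_B\, w(X_1,X_2)]$, the excess mean customer waiting time relative to the $w$-threshold policy of splitting probability $p$ satisfies $$\Delta W_q=\frac{A^*-A}{2},$$ where $A^*=-\mathbb{E}[\sigma^*(X_1,X_2)\,w(X_1,X_2)]$ is the payoff of the $w$-threshold policy.
   Context: Queueing model. Fix $\lambda,\mu>0$ with $\rho=\lambda/\mu<1$. There are two identical first-come-first-served servers with unlimited queues. Customers arrive in pairs according to a Poisson process of rate $\lambda$; the service times $X_1,X_2$ of a pair are i.i.d. $\mathrm{Exp}(\mu)$, independent across pairs. If a pair with service times $(x_1,x_2)$ is split (one customer to each server) with probability $r(x_1,x_2)$ and otherwise bunched (both to the same server), the splitting probability is $p=\mathbb{E}[r(X_1,X_2)]$. Server assignment is load-balanced: when splitting, each server is equally likely to receive either customer; when bunching, the destination server is uniformly random, and a uniformly random one of the two customers goes first. Each server is then an $M^X/G/1$ queue with batch arrival rate $\Lambda=\lambda(1+p)/2$, utilization $\rho$, and batch workload $B_s$ satisfying $\Lambda\mathbb{E}[B_s^2]=\frac{\lambda}{2}\mathbb{E}[(1-r)(X_1+X_2)^2+r(X_1^2+X_2^2)]$, and the mean customer waiting time is the Pollaczek--Khinchine mean virtual wait plus the mean within-batch delay: $\mathbb{E}[W_q]=\frac{\Lambda\mathbb{E}[B_s^2]}{2(1-\rho)}+\frac14\mathbb{E}[(1-r)(X_1+X_2)]$. Routing strategies. Router A observes $X_1$ and outputs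 $o_A\in\{+1,-1\}$; router B observes $X_2$ and outputs $o_B\in\{+1,-1\}$ (deterministically or using shared randomness or entanglement). The pair is split iff $o_Ao_B=-1$ and bunched iff $o_Ao_B=+1$, so $r(x_1,x_2)=\Pr[o_Ao_B=-1\mid X_1=x_1,X_2=x_2]$. Splitting benefit: $w(x_1,x_2)=c_1x_1x_2+c_2(x_1+x_2)$, $c_1=\frac{\lambda}{2(1-\rho)}$, $c_2=\frac14$. Threshold $\tau_p$: $\Pr[w(X_1,X_2)>\tau_p]=p$. The $w$-threshold policy splits iff $w>\tau_p$; it corresponds to $o_Ao_B=\sigma^*(X_1,X_2)$ with $\sigma^*(x_1,x_2)=\mathrm{sign}(\tau_p-w(x_1,x_2))$. $\Delta W_q$ is $\mathbb{E}[W_q]$ of the strategy minus $\mathbb{E}[W_q]$ of the $w$-threshold policy. *)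

(* Defs.v *)
(* MathComp / MathComp-Analysis world. *)
From HB Require Import structures.
From mathcomp Require Import all_boot all_order all_algebra.
From mathcomp Require Import all_classical all_reals all_analysis.
From mathcomp Require Import ring lra.

Set Implicit Arguments.
Unset Strict Implicit.
Unset Printing Implicit Defensive.

Import Order.TTheory GRing.Theory Num.Theory.

Local Open Scope classical_set_scope.
Local Open Scope ring_scope.

Notation pair_space R := (measurableTypeR R * measurableTypeR R)%type.

(* exponential_prob mu is a probability only when 0 < mu, hence the proof
   argument. *)
Definition exponential_law (R : realType) (mu : R) (mu0 : 0 < mu) :
  probability (measurableTypeR R) R.
Proof. refine (exponential_prob mu : probability _ _); exact: mu0. Defined.

Definition pair_law (R : realType) (mu : R) (mu0 : 0 < mu) :
    probability (pair_space R) R :=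
  (exponential_law mu0 \x exponential_law mu0)%E.

Definition mean (R : realType) (Q : probability (pair_space R) R)
    (f : pair_space R -> R) : R :=
  fine ('E_Q[f])%E.

(** Routing strategies *)

(* false stands for the output +1 and true for the output -1. *)
Definition output_sign (R : realType) (o : bool) : R := (-1) ^+ o.

(* A strategy is given by the conditional law of the two outputs,
     outputs_prob x (a, b) = Pr[o_A = a, o_B = b | (X_1, X_2) = x].
   That router A only observes x.1 and router B only observes x.2 is expressed
   by the no-signalling conditions: the law of each output is a function of the
   service time observed by that router.  Deterministic strategies, shared
   randomness and entanglement all produce such conditional laws. *)
Record routing_strategy (R : realType) := RoutingStrategy {
  outputs_prob : pair_space R -> bool * bool -> R ;
  measurable_outputs_prob : forall o,
    measurable_fun [set: pair_space R] (fun x => outputs_prob x o) ;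
  outputs_prob_ge0 : forall x o, 0 <= outputs_prob x o ;
  outputs_prob_sum1 : forall x, \sum_(o : bool * bool) outputs_prob x o = 1 ;
  no_signalling_A : forall (x1 x2 x2' : R) (a : bool),
    \sum_(b : bool) outputs_prob (x1, x2) (a, b) =
    \sum_(b : bool) outputs_prob (x1, x2') (a, b) ;
  no_signalling_B : forall (x1 x1' x2 : R) (b : bool),
    \sum_(a : bool) outputs_prob (x1, x2) (a, b) =
    \sum_(a : bool) outputs_prob (x1', x2) (a, b)
}.

Definition outputs_product (R : realType) (o : bool * bool) : R :=
  output_sign R o.1 * output_sign R o.2.

(* r(x_1, x_2) = Pr[o_A o_B = -1 | X_1 = x_1, X_2 = x_2]. *)
Definition split_fun (R : realType) (S : routing_strategy R)
    (x : pair_space R) : R :=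
  \sum_(o : bool * bool | outputs_product R o == -1) outputs_prob S x o.

Definition splitting_prob (R : realType) (Q : probability (pair_space R) R)
    (r : pair_space R -> R) : R :=
  mean Q r.

(** Splitting benefit, game payoff and threshold policy *)

Definition benefit (R : realType) (lambda mu : R) (x : pair_space R) : R :=
  let c1 := lambda / (2 * (1 - lambda / mu)) in
  let c2 := 4^-1 in
  c1 * (x.1 * x.2) + c2 * (x.1 + x.2).

(* - E[o_A o_B w(X_1, X_2)], under the joint law of the service times and the
   outputs. *)
Definition payoff (R : realType) (Q : probability (pair_space R) R)
    (w : pair_space R -> R) (S : routing_strategy R) : R :=
  - mean Q (fun x =>
      \sum_(o : bool * bool) outputs_prob S x o * (outputs_product R o * w x)).

(* The threshold is an extended real: since w(X_1, X_2) is unbounded, the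
   splitting probability p = 0 is only reached at tau = +oo. *)
Definition is_threshold (R : realType) (Q : probability (pair_space R) R)
    (w : pair_space R -> R) (p : R) (tau : \bar R) : Prop :=
  Q [set x | (tau < (w x)%:E)%E] = p%:E.

Definition threshold_policy (R : realType) (w : pair_space R -> R)
    (tau : \bar R) (x : pair_space R) : R :=
  ((tau < (w x)%:E)%E)%:R.

Definition ereal_sign (R : realType) (y : \bar R) : R :=
  match y with
  | a%:E => Num.sg a
  | +oo%E => 1
  | -oo%E => -1
  end.

Definition sigma_star (R : realType) (w : pair_space R -> R) (tau : \bar R)
    (x : pair_space R) : R :=
  ereal_sign (tau - (w x)%:E)%E.

Definition payoff_star (R : realType) (Q : probability (pair_space R) R)
    (w : pair_space R -> R) (tau : \bar R) : R :=
  - mean Q (fun x => sigma_star w tau x * w x).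

(** Queueing model *)

(* The two customers of a pair and the two servers are both indexed by bool;
   customer false has service time x.1 and customer true has service time
   x.2. *)
Definition service_time (R : realType) (x : pair_space R) (i : bool) : R :=
  if i then x.2 else x.1.

(* The outcome of the routing of one pair: whether it is split, the server of
   customer false, and the customer who goes first when the pair is bunched. *)
Record routing := Routing {
  is_split : bool ;
  server0 : bool ;
  goes_first : bool
}.

Definition server (z : routing) (i : bool) : bool :=
  server0 z (+) (i && is_split z).

(* The mean of f(X_1, X_2, Z), where the routing Z of the pair is a split with
   conditional probability r(X_1, X_2) and is load-balanced: given the service
   times and the decision to split or not, server0 Z and goes_first Z are
   independent fair coins. *)
Definition routed_mean (R : realType) (Q : probability (pair_space R) R)
    (r : pair_space R -> R) (f : pair_space R -> routing -> R) : R :=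
  mean Q (fun x =>
    \sum_(s : bool) \sum_(u : bool) \sum_(v : bool)
      (if s then r x else 1 - r x) * (2^-1 * 2^-1) * f x (Routing s u v)).

Definition has_batch (k : bool) (z : routing) : bool :=
  (server z false == k) || (server z true == k).

Definition workload (R : realType) (k : bool) (x : pair_space R)
    (z : routing) : R :=
  \sum_(i : bool | server z i == k) service_time x i.

Definition batch_prob (R : realType) (Q : probability (pair_space R) R)
    (r : pair_space R -> R) (k : bool) : R :=
  routed_mean Q r (fun _ z => (has_batch k z)%:R).

(* Pairs arrive at rate lambda, and those that send somebody to server k form
   its batch arrivals (Poisson thinning). *)
Definition batch_rate (R : realType) (Q : probability (pair_space R) R)
    (lambda : R) (r : pair_space R -> R) (k : bool) : R :=
  lambda * batch_prob Q r k.

(* E[B_s^2], where B_s is the workload that a pair brings to server k given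
   that it brings a batch there. *)
Definition batch_second_moment (R : realType)
    (Q : probability (pair_space R) R) (r : pair_space R -> R) (k : bool) : R :=
  routed_mean Q r (fun x z => (has_batch k z)%:R * workload k x z ^+ 2) /
  batch_prob Q r k.

(* The Pollaczek-Khinchine mean virtual wait of the M^X/G/1 queue at server k,
   whose utilization is rho = lambda / mu. *)
Definition virtual_wait (R : realType) (Q : probability (pair_space R) R)
    (lambda mu : R) (r : pair_space R -> R) (k : bool) : R :=
  batch_rate Q lambda r k * batch_second_moment Q r k /
  (2 * (1 - lambda / mu)).

Definition batch_delay (R : realType) (x : pair_space R) (z : routing)
    (i : bool) : R :=
  if ~~ is_split z && (goes_first z != i) then service_time x (~~ i) else 0.

(* E[W_q], the mean over a uniformly random customer of a pair. *)
Definition mean_wait (R : realType) (Q : probability (pair_space R) R)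
    (lambda mu : R) (r : pair_space R -> R) : R :=
  routed_mean Q r (fun x z =>
    2^-1 * \sum_(i : bool)
      (virtual_wait Q lambda mu r (server z i) + batch_delay x z i)).

Lemma batch_probE (R : realType) (Q : probability (pair_space R) R)
    (r : pair_space R -> R) (k : bool) :
  batch_prob Q r k = mean Q (fun x => (1 + r x) / 2).
Proof.
rewrite /batch_prob /routed_mean; congr mean; apply/funext => x.
by rewrite !big_bool /has_batch /server; case: k => /=; field.
Qed.

Lemma workloadE (R : realType) (k : bool) (x : pair_space R) (z : routing) :
  workload k x z = (server z false == k)%:R * x.1 + (server z true == k)%:R * x.2.
Proof.
rewrite /workload big_mkcond big_bool /service_time addrC.
by do 2 case: eqP => _ /=; rewrite ?(mul0r, mul1r).
Qed.

Lemma batch_workloadE (R : realType) (Q : probability (pair_space R) R)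
    (r : pair_space R -> R) (k : bool) :
  routed_mean Q r (fun x z => (has_batch k z)%:R * workload k x z ^+ 2) =
  mean Q (fun x => 2^-1 * ((1 - r x) * (x.1 + x.2) ^+ 2 +
                           r x * (x.1 ^+ 2 + x.2 ^+ 2))).
Proof.
rewrite /routed_mean; congr mean; apply/funext => x.
by rewrite !big_bool !workloadE /has_batch /server; case: k => /=; field.
Qed.

Lemma batch_delayE (R : realType) (Q : probability (pair_space R) R)
    (r : pair_space R -> R) :
  routed_mean Q r (fun x z => 2^-1 * \sum_(i : bool) batch_delay x z i) =
  mean Q (fun x => 4^-1 * ((1 - r x) * (x.1 + x.2))).
Proof.
rewrite /routed_mean; congr mean; apply/funext => x.
by rewrite !big_bool /batch_delay /service_time /=; field.
Qed.

(* Main.v *)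
(* With c1 the Pollaczek-Khinchine factor lambda / (2 (1 - rho)), expanding the
   squares gives
     (1 - r) (x1 + x2)^2 + r (x1^2 + x2^2) = (x1 + x2)^2 - 2 r x1 x2,
   so that E[W_q] = K - E[r w] for a constant K not depending on r.  On the
   other side o_A o_B has conditional mean 1 - 2 r, so A = 2 E[r w] - E[w], and
   the same holds for the threshold policy because {w = tau} is a null set.
   All the expectations are finite as exponential laws have moments of every
   order. *)
Require Import Defs.
From HB Require Import structures.
From mathcomp Require Import all_boot all_order all_algebra.
From mathcomp Require Import all_classical all_reals all_analysis.
From mathcomp Require Import measurable_realfun.
From mathcomp Require Import ring lra.

Set Implicit Arguments.
Unset Strict Implicit.
Unset Printing Implicit Defensive.

Import Order.TTheory GRing.Theory Num.Theory.

Local Open Scope classical_set_scope.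
Local Open Scope ring_scope.

(** * Density and moments of the exponential law *)

Lemma measurable_EFin_exponential_pdf (R : realType) (mu : R) :
  measurable_fun setT
    ((fun x => (exponential_pdf mu x)%:E) : measurableTypeR R -> \bar R).
Proof. by apply/measurable_EFinP; exact: measurable_exponential_pdf. Qed.

Lemma exponential_law_dominates (R : realType) (mu : R) (mu0 : 0 < mu) :
  exponential_law mu0 `<< (@lebesgue_measure R).
Proof.
apply/null_content_dominatesP => A mA A0.
apply: null_set_integral => //.
exact: measurable_funS (measurable_EFin_exponential_pdf mu).
Qed.

(** The Radon-Nikodym derivative of the law and [exponential_pdf] have the same integral over every
    measurable set, so they agree almost everywhere and may be exchanged under the integral. *)
Lemma ge0_integral_exponential_law (R : realType) (mu : R) (mu0 : 0 < mu)
    (f : measurableTypeR R -> \bar R) :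
    measurable_fun setT f -> (forall x, 0 <= f x)%E ->
  (\int[exponential_law mu0]_x f x =
   \int[lebesgue_measure]_x (f x * (exponential_pdf mu x)%:E))%E.
Proof.
move=> mf f0; have dom := exponential_law_dominates mu0.
have RNint := Radon_Nikodym_SigmaFinite.f_integrable dom.
rewrite -(Radon_Nikodym_SigmaFinite.change_of_variables dom)//.
apply: ge0_ae_eq_integral => //.
- by apply: emeasurable_funM => //; exact: measurable_int RNint.
- by apply: emeasurable_funM => //; exact: measurable_EFin_exponential_pdf.
- by move=> x _; rewrite mule_ge0// Radon_Nikodym_SigmaFinite.f_ge0.
- by move=> x _; rewrite mule_ge0// lee_fin exponential_pdf_ge0// ltW.
- apply: ae_eqe_mul2l; apply: integral_ae_eq => //.
    exact: measurable_EFin_exponential_pdf.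
  move=> E _ mE; by rewrite -Radon_Nikodym_SigmaFinite.f_integral.
Qed.

Lemma exponential_law_set1 (R : realType) (mu : R) (mu0 : 0 < mu) (a : R) :
  exponential_law mu0 [set a] = 0%E.
Proof.
have /null_content_dominatesP := exponential_law_dominates mu0.
by apply => //; exact: lebesgue_measure_set1.
Qed.

(** A single term of the exponential series, all of whose terms are nonnegative here. *)
Lemma expR_ge_pow (R : realType) (x : R) (n : nat) :
  0 <= x -> x ^+ n / n`!%:R <= expR x.
Proof.
case: n => [|n] x0; first by rewrite expr0 divr1 -expR0 ler_expR.
by apply: le_trans (expR_ge1Dxn n x0); rewrite lerDr.
Qed.

(* x ^+ n is at most a multiple of expR (mu x / 2), which turns the density of
   rate mu into a multiple of the density of rate mu / 2. *)
Lemma integrable_exponential_law_pow (R : realType) (mu : R) (mu0 : 0 < mu)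
    (n : nat) :
  (exponential_law mu0).-integrable setT (fun x => (x ^+ n)%:E).
Proof.
have mX : measurable_fun [set: measurableTypeR R] (fun x => (x ^+ n)%:E).
  by apply/measurable_EFinP; exact: exprn_measurable.
apply/integrableP; split => //.
rewrite ge0_integral_exponential_law//; last exact: measurableT_comp.
(* With [y = mu / 2 * x], the factor [(2 / mu) ^+ n] turns [x ^+ n] into [y ^+ n], the factorial
   bounds [y ^+ n] by a multiple of [expR y], and the last 2 is the ratio of the rates [mu] and
   [mu / 2]. *)
set C := n`!%:R * (2 / mu) ^+ n * 2.
have mu20 : 0 < mu / 2 by lra.
have C0 : 0 <= C by rewrite !mulr_ge0// exprn_ge0// divr_ge0// ltW.
apply: (@le_lt_trans _ _
  (\int[lebesgue_measure]_x (C%:E * (exponential_pdf (mu / 2) x)%:E))%E).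
  apply: ge0_le_integral => //.
  - by move=> x _; rewrite mule_ge0// lee_fin exponential_pdf_ge0// ltW.
  - apply: emeasurable_funM; first exact: measurableT_comp.
    exact: measurable_EFin_exponential_pdf.
  - by apply: emeasurable_funM => //; exact: measurable_EFin_exponential_pdf.
  - move=> x _; rewrite -EFinM lee_fin.
    (* Both densities vanish on the negative half-line. *)
    have [x0|x0] := ltP x 0; first by rewrite !lt0_exponential_pdf// !mulr0.
    rewrite ger0_norm ?exprn_ge0// !exponential_pdfE//.
    set y := mu / 2 * x; have y0 : 0 <= y by rewrite mulr_ge0// ltW.
    have -> : - mu * x = - y + - y by rewrite /y; field.
    have -> : - (mu / 2) * x = - y by rewrite /y mulNr.
    have -> : x = 2 / mu * y by rewrite /y; field; rewrite gt_eqF.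
    rewrite expRD exprMn; set k := (2 / mu) ^+ n; set e := expR (- y).
    (* Once the common factor [k * mu * e] is removed, the claim is that [y ^+ n * expR (- y)] is at
       most the factorial of [n]. *)
    rewrite (_ : _ * _ * _ = k * mu * e * (y ^+ n * e)); last by ring.
    rewrite (_ : C * _ = k * mu * e * n`!%:R); last by rewrite /C -/k; field.
    apply: ler_wpM2l.
      by rewrite !mulr_ge0 ?expR_ge0 ?exprn_ge0 ?divr_ge0// ltW.
    rewrite /e expRN ler_pdivrMr ?expR_gt0// mulrC -ler_pdivrMr.
      exact: expR_ge_pow.
    by rewrite ltr0n fact_gt0.
rewrite ge0_integralZl//; last 2 first.
- exact: measurable_EFin_exponential_pdf.
- by move=> x _; rewrite lee_fin exponential_pdf_ge0// ltW.
by rewrite integral_exponential_pdf// mule1 ltry.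
Qed.

(** * Integrability and null sets under product laws *)

Lemma integrable_prodM (d1 d2 : measure_display) (T1 : measurableType d1)
    (T2 : measurableType d2) (R : realType) (P1 : probability T1 R)
    (P2 : probability T2 R) (f : T1 -> R) (g : T2 -> R) :
    P1.-integrable setT (EFin \o f) -> P2.-integrable setT (EFin \o g) ->
  (P1 \x P2)%E.-integrable setT (fun x => (f x.1 * g x.2)%:E).
Proof.
move=> /integrableP[mf fi] /integrableP[mg gi].
have mf1 : measurable_fun [set: T1 * T2] (fun x => (f x.1)%:E).
  exact: measurableT_comp mf measurable_fst.
have mg2 : measurable_fun [set: T1 * T2] (fun x => (g x.2)%:E).
  exact: measurableT_comp mg measurable_snd.
have mfg : measurable_fun [set: T1 * T2] (fun x => (f x.1 * g x.2)%:E).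
  exact: (emeasurable_funM mf1 mg2).
have mabs d (T : measurableType d) (h : T -> R) :
    measurable_fun setT (EFin \o h) -> measurable_fun setT (fun x => `|h x|%:E).
  move=> /measurable_EFinP mh; apply/measurable_EFinP.
  exact: measurableT_comp mh.
apply/integrableP; split => //.
(* By Tonelli the integral of the norm factors into two one-variable integrals, both finite. *)
rewrite fubini_tonelli1//=; last exact: mabs mfg.
rewrite /fubini_F /=.
under eq_integral => x _.
  under eq_integral do rewrite normrM EFinM.
  rewrite ge0_integralZl//; last exact: mabs.
  over.
rewrite /= ge0_integralZr//; last 2 first.
- exact: mabs.
- by apply: integral_ge0 => y _; rewrite lee_fin.
have f0 : (0 <= \int[P1]_x `|f x|%:E)%E.
  by apply: integral_ge0 => x _; rewrite lee_fin.
by apply: lte_mul_pinfty => //; rewrite ge0_fin_numE.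
Qed.

Lemma integrable_pair_law_monomial (R : realType) (mu : R) (mu0 : 0 < mu)
    (m n : nat) :
  (pair_law mu0).-integrable setT (fun x => (x.1 ^+ m * x.2 ^+ n)%:E).
Proof.
exact: (integrable_prodM (integrable_exponential_law_pow mu0 m)
  (integrable_exponential_law_pow mu0 n)).
Qed.

Lemma measurable_bilinear (R : realType) (a b : R) :
  measurable_fun [set: pair_space R]
    (fun x => a * (x.1 * x.2) + b * (x.1 + x.2)).
Proof.
by apply: measurable_funD; apply: measurable_funM => //;
   [apply: measurable_funM|apply: measurable_funD].
Qed.

Lemma measurable_benefit (R : realType) (lambda mu : R) :
  measurable_fun [set: pair_space R] (benefit lambda mu).
Proof. exact: measurable_bilinear. Qed.

Lemma measurable_level (d : measure_display) (T : measurableType d)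
    (R : realType) (w : T -> R) (t : R) :
  measurable_fun setT w -> measurable [set x | w x = t].
Proof.
move=> mw; rewrite -[X in measurable X]setTI.
exact: (mw measurableT _ (measurable_set1 t)).
Qed.

(* For fixed x.1 != - b / a the equation is affine in x.2 with a unique root. *)
Lemma pair_law_bilinear_level0 (R : realType) (mu : R) (mu0 : 0 < mu)
    (a b t : R) : a != 0 ->
  pair_law mu0 [set x | a * (x.1 * x.2) + b * (x.1 + x.2) = t] = 0%E.
Proof.
move=> a0; set A := [set x | _].
have mA := measurable_level t (measurable_bilinear a b).
(* The product measure integrates the measures of the sections at fixed [x.1], so it suffices that
   almost every section is null. *)
rewrite /= /product_measure1.
rewrite (ae_eq_integral (cst 0%E))// ?integral_cst ?mul0e//.
  exact: measurable_fun_xsection.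
exists [set - b / a]; split => //; first exact: exponential_law_set1.
move=> x /= /not_implyP[_ nx]; apply: contrapT => xab; apply: nx.
have axb : a * x + b != 0.
  apply/eqP => e; apply: xab; rewrite -[b](addrK (a * x)) [b + _]addrC e.
  by field.
apply/eqP; rewrite -measure_le0.
(* The section lies in the singleton of the root of the affine equation, which the atomless law does
   not charge. *)
rewrite -(exponential_law_set1 mu0 ((t - b * x) / (a * x + b))).
apply: le_measure; rewrite ?inE//; first exact: measurable_xsection.
move=> y; rewrite /xsection /= inE /A /= => <-.
by field.
Qed.

(** * Calculus of means and the virtual wait, for an arbitrary law of the pair *)

Section mean.
Variables (R : realType) (Q : probability (pair_space R) R).
Implicit Types (f g r w : pair_space R -> R) (S : routing_strategy R).

Notation integ f := (Q.-integrable setT (EFin \o f)).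

Lemma meanE f : mean Q f = \int[Q]_x f x.
Proof. by rewrite /mean unlock. Qed.

Lemma meanD f g : integ f -> integ g ->
  mean Q (fun x => f x + g x) = mean Q f + mean Q g.
Proof. by move=> fi gi; rewrite !meanE RintegralD. Qed.

Lemma meanB f g : integ f -> integ g ->
  mean Q (fun x => f x - g x) = mean Q f - mean Q g.
Proof. by move=> fi gi; rewrite !meanE RintegralB. Qed.

Lemma meanZl (k : R) f : integ f -> mean Q (fun x => k * f x) = k * mean Q f.
Proof. by move=> fi; rewrite !meanE RintegralZl. Qed.

Lemma mean_cst (k : R) : mean Q (fun=> k) = k.
Proof. by rewrite /mean (expectation_cst Q k). Qed.

Lemma eq_integ f g : f =1 g -> integ f -> integ g.
Proof. by move=> /funext ->. Qed.

Lemma integ_cst (k : R) : integ (fun=> k).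
Proof. exact: finite_measure_integrable_cst. Qed.

Lemma integD f g : integ f -> integ g -> integ (fun x => f x + g x).
Proof. by move=> fi gi; exact: (integrableD measurableT fi gi). Qed.

Lemma integZl (k : R) f : integ f -> integ (fun x => k * f x).
Proof. by move=> fi; exact: (integrableZl measurableT k fi). Qed.

Lemma integB f g : integ f -> integ g -> integ (fun x => f x - g x).
Proof. by move=> fi gi; exact: (integrableB measurableT fi gi). Qed.

(** Domination by [f]. This makes the means finite for every splitting function at once. *)
Lemma integM01 r f : measurable_fun setT r -> (forall x, 0 <= r x <= 1) ->
  integ f -> integ (fun x => r x * f x).
Proof.
move=> mr r01 fi; apply: (le_integrable measurableT _ _ fi).
  have /measurable_EFinP mf := measurable_int _ fi.
  by apply/measurable_EFinP; exact: measurable_funM.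
move=> x _; rewrite lee_fin normrM; have /andP[r0 r1] := r01 x.
by rewrite (ger0_norm r0) ler_piMl.
Qed.

Lemma splitting_prob_ge0 r : (forall x, 0 <= r x <= 1) ->
  0 <= splitting_prob Q r.
Proof.
move=> r01; rewrite /splitting_prob meanE.
by apply: Rintegral_ge0 => x _; have /andP[] := r01 x.
Qed.

(** The value is the mean of [(1 + r x) / 2], hence at least one half. It serves to cancel the
    conditioning in [batch_second_moment]. *)
Lemma batch_prob_gt0 r (k : bool) : measurable_fun setT r ->
  (forall x, 0 <= r x <= 1) -> 0 < batch_prob Q r k.
Proof.
move=> mr r01; have ri : integ r.
  by apply: eq_integ (integM01 mr r01 (integ_cst 1)) => x; rewrite mulr1.
rewrite batch_probE (_ : (fun x => _) = (fun x => 2^-1 * (1 + r x))); last first.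
  by apply/funext => x; rewrite mulrC.
rewrite meanZl ?meanD ?mean_cst//; [|exact: integ_cst|].
  have := splitting_prob_ge0 r01; rewrite /splitting_prob; lra.
by apply: integD => //; exact: integ_cst.
Qed.

(** The batch probability in the arrival rate cancels the one that normalizes the second moment.
    Both servers thus get the same value. *)
Lemma virtual_waitE (lambda mu : R) r (k : bool) :
    measurable_fun setT r -> (forall x, 0 <= r x <= 1) ->
  virtual_wait Q lambda mu r k = lambda / (2 * (1 - lambda / mu)) *
    mean Q (fun x => 2^-1 * ((1 - r x) * (x.1 + x.2) ^+ 2 +
                           r x * (x.1 ^+ 2 + x.2 ^+ 2))).
Proof.
move=> mr r01; have bp := batch_prob_gt0 k mr r01.
rewrite /virtual_wait /batch_rate /batch_second_moment batch_workloadE.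
set M := mean _ _; set D := (2 * _)^-1.
by field; rewrite gt_eqF.
Qed.

(** * Payoffs of a strategy and of the threshold policy in terms of their splitting functions *)

Lemma split_fun01 S x : 0 <= split_fun S x <= 1.
Proof.
rewrite /split_fun sumr_ge0 => [/=|o _]; last exact: outputs_prob_ge0.
have := outputs_prob_sum1 S x.
rewrite (bigID (fun o => outputs_product R o == -1))/= => sum1.
rewrite -[leRHS]sum1.
by rewrite lerDl sumr_ge0// => o _; exact: outputs_prob_ge0.
Qed.

Lemma measurable_split_fun S : measurable_fun setT (split_fun S).
Proof.
rewrite /split_fun; under eq_fun do rewrite big_mkcond.
apply: measurable_sum => o; case: (_ == -1); last exact: measurable_cst.
exact: measurable_outputs_prob.
Qed.

(** The four outcomes are grouped by the sign of their product: -1 has conditional weight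
    [split_fun S x], and +1 has the complementary weight. *)
Lemma payoffE w S :
  payoff Q w S = - mean Q (fun x => (1 - 2 * split_fun S x) * w x).
Proof.
rewrite /payoff; congr (- mean _ _); apply/funext => x.
have sum1 := outputs_prob_sum1 S x.
rewrite (bigID (fun o => outputs_product R o == -1))/= -/(split_fun S x) in sum1.
rewrite [LHS](bigID (fun o => outputs_product R o == -1))/=.
have -> : \sum_(o | outputs_product R o == -1)
    outputs_prob S x o * (outputs_product R o * w x) = - split_fun S x * w x.
  rewrite -sumrN mulr_suml; apply: eq_bigr => o /eqP ->.
  by rewrite mulN1r mulrN mulNr.
have -> : \sum_(o | outputs_product R o != -1)
    outputs_prob S x o * (outputs_product R o * w x) = (1 - split_fun S x) * w x.
  rewrite (_ : 1 - _ = \sum_(o | outputs_product R o != -1) outputs_prob S x o);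
    last by apply/eqP; rewrite subr_eq addrC sum1.
  rewrite mulr_suml.
  apply: eq_bigr => -[[] []]; rewrite /outputs_product /output_sign /= ?expr0
    ?expr1 ?mulrN ?mulNr ?mulr1 ?opprK ?mul1r ?eqxx//.
by ring.
Qed.

Lemma threshold_policy01 w tau x : 0 <= threshold_policy w tau x <= 1.
Proof. by rewrite /threshold_policy ler0n lern1 leq_b1. Qed.

Lemma measurable_threshold_policy w tau : measurable_fun setT w ->
  measurable_fun setT (threshold_policy w tau).
Proof.
move=> mw; have mA : measurable [set x | (tau < (w x)%:E)%E].
  rewrite -[X in measurable X]setTI; apply: measurable_lte => //.
  exact/measurable_EFinP.
rewrite (_ : threshold_policy w tau = \1_[set x | (tau < (w x)%:E)%E]).
  exact: measurable_indic.
by apply/funext => x; rewrite /threshold_policy indicE mem_setE.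
Qed.

(* [sigma_star] is 0 on ties, whereas the policy bunches there. *)
Lemma sigma_starE w tau x : sigma_star w tau x =
  1 - 2 * threshold_policy w tau x - (tau == (w x)%:E)%:R.
Proof.
rewrite /sigma_star /threshold_policy; case: tau => [t| |] /=.
- rewrite lte_fin eqe; have [tw|wt|->] := ltgtP t (w x).
  + by rewrite ltr0_sg ?subr_lt0// /=; ring.
  + by rewrite gtr0_sg ?subr_gt0// /=; ring.
  + by rewrite subrr sgr0 /=; ring.
- by rewrite /=; ring.
- by rewrite ltNyr /=; ring.
Qed.

Lemma payoff_starE w tau : measurable_fun setT w ->
    (forall t : R, Q [set x | w x = t] = 0%E) ->
  payoff_star Q w tau =
  - mean Q (fun x => (1 - 2 * threshold_policy w tau x) * w x).
Proof.
move=> mw w0; rewrite /payoff_star !meanE /Rintegral; congr (- fine _).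
have mthr : measurable_fun setT (threshold_policy w tau).
  exact: measurable_threshold_policy.
have mpol : measurable_fun setT (fun x => (1 - 2 * threshold_policy w tau x)).
  by apply: measurable_funB => //; exact: measurable_funM.
have mtie : measurable_fun setT (fun x => (tau == (w x)%:E)%:R : R).
  case: tau {mthr mpol} => [t| |]; [|exact: measurable_cst..].
  rewrite (_ : (fun x => _) = \1_[set x | w x = t]).
    by apply: measurable_indic; exact: measurable_level.
  apply/funext => x; rewrite indicE eqe eq_sym; congr (_%:R).
  by congr nat_of_bool; apply/eqP/idP => [|/set_mem]; rewrite ?inE.
apply: ae_eq_integral => //.
- apply/measurable_EFinP; apply: measurable_funM => //.
  rewrite (funext (sigma_starE w tau)); exact: measurable_funB.
- by apply/measurable_EFinP; exact: measurable_funM.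
(* For infinite [tau] there are no ties; [fine tau] is then the default 0, and the exceptional set
   is merely some null level set. *)
- exists [set x | w x = fine tau]; split; [exact: measurable_level|exact: w0|].
  move=> x /= /not_implyP[_ ne]; apply: contrapT => nw; apply: ne.
  rewrite sigma_starE; case: eqP => [taw|]; last by rewrite subr0.
  by case: nw; rewrite taw.
Qed.

End mean.

(** * Mean wait under the exponential pair law *)

Lemma integrable_pair_law_add (R : realType) (mu : R) (mu0 : 0 < mu) :
  (pair_law mu0).-integrable setT (EFin \o (fun x => x.1 + x.2)).
Proof.
have X := integrable_pair_law_monomial mu0.
by apply: eq_integ (integD (X 1%N 0%N) (X 0%N 1%N)) => x; ring.
Qed.

Lemma integrable_pair_law_mul (R : realType) (mu : R) (mu0 : 0 < mu) :
  (pair_law mu0).-integrable setT (EFin \o (fun x => x.1 * x.2)).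
Proof.
by apply: eq_integ (integrable_pair_law_monomial mu0 1 1) => x; ring.
Qed.

Lemma integrable_benefit (R : realType) (lambda mu : R) (mu0 : 0 < mu) :
  (pair_law mu0).-integrable setT (EFin \o benefit lambda mu).
Proof.
exact: (integD (integZl _ (integrable_pair_law_mul mu0))
  (integZl _ (integrable_pair_law_add mu0))).
Qed.

(** The first mean does not involve [r], so it disappears from the difference of two mean waits. *)
Lemma mean_waitE (R : realType) (lambda mu : R) (mu0 : 0 < mu)
    (r : pair_space R -> R) :
    measurable_fun setT r -> (forall x, 0 <= r x <= 1) ->
  mean_wait (pair_law mu0) lambda mu r =
  mean (pair_law mu0) (fun x => lambda / (2 * (1 - lambda / mu)) *
    (2^-1 * (x.1 + x.2) ^+ 2) + 4^-1 * (x.1 + x.2)) -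
  mean (pair_law mu0) (fun x => r x * benefit lambda mu x).
Proof.
move=> mr r01; set c := lambda / _; set Q := pair_law mu0.
have X m n := integrable_pair_law_monomial mu0 m n.
have Xs := integrable_pair_law_add mu0; have Xp := integrable_pair_law_mul mu0.
have Xq : Q.-integrable setT (EFin \o (fun x => (x.1 + x.2) ^+ 2)).
  apply: eq_integ (integD (integD (X 2%N 0%N) (X 0%N 2%N)) (integZl 2 Xp)) => x.
  by ring.
have Xw := integrable_benefit lambda mu0.
set G := fun x : pair_space R => 2^-1 * ((1 - r x) * (x.1 + x.2) ^+ 2 +
  r x * (x.1 ^+ 2 + x.2 ^+ 2)).
have Gi : Q.-integrable setT (EFin \o G).
  (* Expanding the squares, [G x] is half of [(x.1 + x.2) ^+ 2] minus [r x * (x.1 * x.2)]. *)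
  apply: eq_integ (integB (integZl 2^-1 Xq) (integM01 mr r01 Xp)) => x.
  by rewrite /G; field.
set D := fun x : pair_space R => 4^-1 * ((1 - r x) * (x.1 + x.2)).
have Di : Q.-integrable setT (EFin \o D).
  apply: eq_integ (integZl 4^-1 (integB Xs (integM01 mr r01 Xs))) => x.
  by rewrite /D; ring.
(* The virtual wait, equal at both servers, leaves the average over the fair coins as a constant;
   averaging the within-batch delays gives [D]. *)
transitivity (mean Q (fun x => c * mean Q G + D x)).
  rewrite /mean_wait /routed_mean; congr mean; apply/funext => x.
  rewrite !big_bool /= !virtual_waitE// -/c -/G /batch_delay /service_time /D /=.
  by field.
rewrite meanD ?mean_cst//; last exact: integ_cst.
(* All terms are gathered under one mean, which reduces the claim to a pointwise identity. *)
rewrite -meanZl// -meanD//; last exact: integZl.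
rewrite -meanB; last 2 first.
- by apply: integD; apply: integZl => //; exact: integZl.
- exact: integM01.
congr mean; apply/funext => x; rewrite /G /D /benefit -/c.
by field.
Qed.

Theorem lemma1 (R : realType) (lambda mu : R) (lambda0 : 0 < lambda)
    (mu0 : 0 < mu) (rho1 : lambda / mu < 1) (p : R) (p01 : 0 <= p <= 1)
    (S : routing_strategy R)
    (Sp : splitting_prob (pair_law mu0) (split_fun S) = p)
    (tau : \bar R)
    (taup : is_threshold (pair_law mu0) (benefit lambda mu) p tau) :
  mean_wait (pair_law mu0) lambda mu (split_fun S) -
  mean_wait (pair_law mu0) lambda mu
    (threshold_policy (benefit lambda mu) tau) =
  (payoff_star (pair_law mu0) (benefit lambda mu) tau -
   payoff (pair_law mu0) (benefit lambda mu) S) / 2.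
Proof.
have mw := measurable_benefit lambda mu.
have wi := integrable_benefit lambda mu0.
(* Used for both splitting functions: each payoff becomes twice the mean of
   [r x * benefit lambda mu x] minus the common mean benefit. *)
have mean_pol (r : pair_space R -> R) :
    measurable_fun setT r -> (forall x, 0 <= r x <= 1) ->
    mean (pair_law mu0) (fun x => (1 - 2 * r x) * benefit lambda mu x) =
    mean (pair_law mu0) (benefit lambda mu) -
    2 * mean (pair_law mu0) (fun x => r x * benefit lambda mu x).
  move=> mr r01; have rwi := integM01 mr r01 wi.
  rewrite -meanZl// -meanB//; last exact: integZl.
  by congr mean; apply/funext => x; ring.
have mS := measurable_split_fun S; have S01 := split_fun01 S.
have mT := measurable_threshold_policy tau mw.
have T01 := threshold_policy01 (benefit lambda mu) tau.
(* Level sets of the benefit are null because its bilinear coefficient is positive, by [lambda0] and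
   [rho1]. *)
rewrite payoff_starE//; last first.
  move=> t; apply: pair_law_bilinear_level0.
  by rewrite gt_eqF// divr_gt0// mulr_gt0// subr_gt0.
rewrite payoffE !mean_waitE// !mean_pol//.
by field.
Qed.
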